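(* Let $q\geq3$. Any two finite paths in the Farey graph $\mathcal{F}_q$ that start at the same vertex and finish at the same vertex are homotopic.
   Context: Let $\lambda_q=2\cos(\pi/q)$, $G_q$ the group generated by $\sigma(z)=-1/z$ and $\tau(z)=z+\lambda_q$, and $\rho(z)=\lambda_q-1/z$. The Farey graph $\mathcal{F}_q$ has vertex set $G_q(\infty)$, with $u,v$ adjacent iff $\{u,v\}=\{g(0),g(\infty)\}$ for some $g\in G_q$. Its faces are the ideal $q$-gons $g(E)$, $g\in G_q$, where $E$ has vertices $\rho^i(\infty)$, $i=0,\dots,q-1$; the boundary circuit of a face is the closed path through its $q$ vertices in cyclic order. A path is a sequence of vertices $\langle v_0,\dots,v_n\rangle$ with consecutive vertices adjacent. Two elementary operations on a path are: (1) inserting or removing a subpath $\langle u,w,u\rangle$ in place of $\langle u\rangle$ (going to a neighbour and immediately back); (2) inserting or removing, at a vertex of a face, a full circuit of the boundary of that face. Two paths are homotopic if one can be transformed into the other by finitely many elementary operations. *)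

(* Defs.v *)
From Stdlib Require Import Relation_Operators.
From mathcomp Require Import all_boot all_order all_algebra.
From mathcomp Require Import all_classical all_reals all_analysis.

Set Implicit Arguments.
Unset Strict Implicit.
Unset Printing Implicit Defensive.

Import Order.TTheory GRing.Theory Num.Theory.

Local Open Scope classical_set_scope.
Local Open Scope ring_scope.

(* The extended real line, with [None] as the point at infinity.  It is
   invariant under the Hecke groups and contains all Farey vertices, and a
   Moebius map is determined by its action on it. *)
Definition xreal (R : realType) : Type := option R.

Definition infty (R : realType) : xreal R := None.

Inductive generated_group (T : Type) (S : set (T -> T)) : set (T -> T) :=
| gen_base f : S f -> generated_group S f
| gen_id : generated_group S id
| gen_comp f g :
    generated_group S f -> generated_group S g -> generated_group S (f \o g)
| gen_inv f g :
    generated_group S f -> cancel f g -> cancel g f -> generated_group S g.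

Section Farey.
Variables (R : realType) (q : nat).

Definition hecke_lambda : R := 2 * cos (pi / q%:R).

Definition sigma (z : xreal R) : xreal R :=
  if z is Some x then (if x == 0 then None else Some (- 1 / x)) else Some 0.

Definition tau (z : xreal R) : xreal R :=
  if z is Some x then Some (x + hecke_lambda) else None.

Definition rho (z : xreal R) : xreal R :=
  if z is Some x then (if x == 0 then None else Some (hecke_lambda - 1 / x))
  else Some hecke_lambda.

Definition hecke_group : set (xreal R -> xreal R) :=
  generated_group [set sigma; tau].

Definition farey_vertex : set (xreal R) :=
  [set g (infty R) | g in hecke_group].

Definition farey_adj (u v : xreal R) : Prop :=
  exists2 g, hecke_group g & [set u; v] = [set g (Some 0); g (infty R)].

Definition farey_path (p : seq (xreal R)) : Prop :=
  [/\ p <> [::],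
      forall i, (i < size p)%N -> farey_vertex (nth (infty R) p i) &
      forall i, (i.+1 < size p)%N ->
        farey_adj (nth (infty R) p i) (nth (infty R) p i.+1)].

(* The vertices of the face [g(E)] in cyclic order. *)
Definition face (g : xreal R -> xreal R) : seq (xreal R) :=
  [seq g (iter i rho (infty R)) | i <- iota 0 q].

(* [c] goes once around a face, from any of its vertices, in either direction. *)
Definition boundary_circuit (c : seq (xreal R)) : Prop :=
  exists2 g, hecke_group g &
  exists k u s, rot k (face g) = u :: s /\
    (c = u :: rcons s u \/ c = u :: rcons (rev s) u).

(* [insertion p p']: [p'] is obtained from [p] by inserting a backtrack or a
   face circuit.  A circuit [u :: c] ends with [u], so that replacing [u] by
   [u :: c] is the insertion of the circuit at [u]. *)
Inductive insertion : seq (xreal R) -> seq (xreal R) -> Prop :=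
| insert_backtrack p1 u w p2 :
    farey_adj u w -> insertion (p1 ++ u :: p2) (p1 ++ [:: u; w; u] ++ p2)
| insert_circuit p1 u c p2 :
    boundary_circuit (u :: c) ->
    insertion (p1 ++ u :: p2) (p1 ++ (u :: c) ++ p2).

Definition elementary (p p' : seq (xreal R)) : Prop :=
  [/\ farey_path p, farey_path p' & insertion p p' \/ insertion p' p].

Definition homotopic : seq (xreal R) -> seq (xreal R) -> Prop :=
  clos_refl_trans _ elementary.

End Farey.

(* Main.v *)
(* Put w = a_1 ... a_n, a word in the letters sigma and rho.  For g in the group,
   the points g (a_1 ... a_i (oo)) form a walk in the Farey graph, in which
   sigma sigma and rho sigma are backtracks, and rho^q and sigma rho^(q-1) are
   circuits of faces.  Deleting sigma sigma and rho^q makes the word reduced.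
   Since rho^i (0 < i < q) maps [-oo, 0] into [0, oo] and sigma maps [0, oo] into
   [-oo, 0], ping-pong, keeping track of the endpoints, shows that a nonempty
   reduced word fixing oo starts with rho sigma or sigma rho^(q-1), which can in
   turn be deleted; so every word fixing oo gives a null-homotopic walk.  An edge
   from g oo leads to h (sigma oo) with h = g k, k fixing oo, so every path is
   homotopic to the walk of a word; two walks w, w' with the same ends are
   compared through the walk of w w^-1 w'. *)
From Stdlib Require Import Relation_Operators.
Require Import Defs.
From mathcomp Require Import all_boot all_order all_algebra.
From mathcomp Require Import all_classical all_reals all_analysis.
From mathcomp Require Import ring lra.

Set Implicit Arguments.
Unset Strict Implicit.
Unset Printing Implicit Defensive.

Import Order.TTheory GRing.Theory Num.Theory.

Local Open Scope classical_set_scope.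
Local Open Scope ring_scope.

(** * The action of [sigma] and [rho] on the extended real line *)

Section HeckeAction.
Variables (R : realType) (q : nat).
Hypothesis q3 : (3 <= q)%N.

Local Notation lam := (hecke_lambda R q).
Local Notation rho := (@rho R q).
Local Notation tau := (@tau R q).
Local Notation sigma := (@sigma R).
Local Notation oo := (infty R).

Lemma sigmaK : involutive sigma.
Proof.
case=> [x|] /=; last by rewrite eqxx.
case: eqP => [->//|/eqP x0] /=.
rewrite ifF; last by rewrite mulf_eq0 oppr_eq0 oner_eq0 invr_eq0 (negPf x0).
by congr Some; field.
Qed.

Lemma rho_sigma : rho \o sigma = tau.
Proof.
apply/funext => -[x|] /=; last by rewrite eqxx.
case: eqP => [->|/eqP x0] /=; first by rewrite add0r.
rewrite ifF; last by rewrite mulf_eq0 oppr_eq0 oner_eq0 invr_eq0 (negPf x0).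
by congr Some; field.
Qed.

(* Homogeneous coordinates; the junk value of [proj] at (0, 0) is infinity. *)
Definition proj (v : R * R) : xreal R :=
  if v.2 == 0 then None else Some (v.1 / v.2).

Definition rho_lin (v : R * R) : R * R := (lam * v.1 - v.2, v.1).

Lemma proj_scale c v : c != 0 -> proj (c * v.1, c * v.2) = proj v.
Proof.
move=> c0; rewrite /proj /= mulf_eq0 (negPf c0) /=.
by case: eqP => // /eqP v0; congr Some; field; rewrite v0 c0.
Qed.

Lemma rho_proj v : v != (0, 0) -> rho (proj v) = proj (rho_lin v).
Proof.
case: v => a b; rewrite /proj /rho_lin /=; have [->|b0] := eqVneq b 0.
  rewrite xpair_eqE eqxx andbT => a0.
  by rewrite (negPf a0) /= subr0 mulfK.
move=> _ /=; rewrite mulf_eq0 invr_eq0 (negPf b0) orbF.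
by case: eqP => // /eqP a0; congr Some; field; rewrite a0 b0.
Qed.

Lemma iter_rho_proj i v : v != (0, 0) ->
  iter i rho (proj v) = proj (iter i rho_lin v) /\ iter i rho_lin v != (0, 0).
Proof.
move=> v0; elim: i => [//|i [IH n0]]; rewrite !iterS IH rho_proj //.
split=> //; apply: contra n0; case: (iter i rho_lin v) => a b.
rewrite /rho_lin /= !xpair_eqE => /andP[/eqP + /eqP a0].
by rewrite a0 mulr0 sub0r eqxx => /eqP; rewrite oppr_eq0 => ->.
Qed.

(** Divided by [sn 1], these are up to sign the entries of the powers of the matrix of [rho], i.e.
    the Chebyshev values U_(i-1)(cos (pi / q)). *)
Definition sn (i : nat) : R := sin (i%:R * (pi / q%:R)).

Lemma sn0 : sn 0 = 0. Proof. by rewrite /sn mul0r sin0. Qed.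

Lemma qR_neq0 : (q%:R : R) != 0.
Proof. by rewrite pnatr_eq0; case: q q3. Qed.

Lemma snq : sn q = 0.
Proof. by rewrite /sn mulrCA divff ?qR_neq0 // mulr1 sinpi. Qed.

Lemma sn_rec i : sn i.+2 = lam * sn i.+1 - sn i.
Proof.
rewrite /sn /hecke_lambda -(addn1 i.+1) natrD mulrDl mul1r sinD.
have -> : (i%:R : R) * (pi / q%:R) = i.+1%:R * (pi / q%:R) - pi / q%:R.
  by rewrite -natr1; ring.
by rewrite sinB; ring.
Qed.

Lemma sn_gt0 i : (0 < i < q)%N -> 0 < sn i.
Proof.
case/andP=> i0 iq; have q0 : (0 : R) < q%:R by rewrite ltr0n; case: q q3.
apply: sin_gt0_pi; rewrite mulrA mulrAC; apply/andP; split.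
  by apply: mulr_gt0 (pi_gt0 R); rewrite divr_gt0 // ltr0n.
by rewrite -[ltRHS]mul1r ltr_pM2r ?pi_gt0 // ltr_pdivrMr // mul1r ltr_nat.
Qed.

Lemma sn_ge0 i : (i <= q)%N -> 0 <= sn i.
Proof.
rewrite leq_eqVlt => /orP[/eqP ->|iq]; first by rewrite snq.
by case: i iq => [|i] iq; [rewrite sn0|rewrite ltW // sn_gt0].
Qed.

Lemma iter_rho_lin i v :
  (sn 1 * (iter i.+1 rho_lin v).1 = sn i.+2 * v.1 - sn i.+1 * v.2) *
  (sn 1 * (iter i.+1 rho_lin v).2 = sn i.+1 * v.1 - sn i * v.2).
Proof.
elim: i => [|i [IH1 IH2]]; first by split; rewrite /rho_lin /= ?sn_rec sn0; ring.
rewrite iterS; case: (iter i.+1 rho_lin v) IH1 IH2 => a b /= IH1 IH2.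
split; last exact: IH1.
transitivity (lam * (sn 1 * a) - sn 1 * b); first by ring.
by rewrite IH1 IH2 (sn_rec i.+1) (sn_rec i); ring.
Qed.

Lemma iter_rhoE i v : v != (0, 0) ->
  iter i.+1 rho (proj v) =
  proj (sn i.+2 * v.1 - sn i.+1 * v.2, sn i.+1 * v.1 - sn i * v.2).
Proof.
move=> v0; have s1 : sn 1 != 0.
  by rewrite gt_eqF // sn_gt0 //; apply: leq_trans q3.
by rewrite (iter_rho_proj _ v0).1 -(proj_scale _ s1) !iter_rho_lin.
Qed.

Definition hvec (x : xreal R) : R * R := if x is Some r then (r, 1) else (1, 0).

Lemma hvec_neq0 x : hvec x != (0, 0).
Proof. by case: x => [r|] /=; rewrite xpair_eqE oner_eq0 ?andbF. Qed.

Lemma hvecK x : proj (hvec x) = x.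
Proof. by case: x => [r|]; rewrite /proj /= ?oner_eq0 ?divr1 ?eqxx. Qed.

Lemma iter_rho_xreal i x : iter i.+1 rho x =
  proj (sn i.+2 * (hvec x).1 - sn i.+1 * (hvec x).2,
        sn i.+1 * (hvec x).1 - sn i * (hvec x).2).
Proof. by rewrite -{1}(hvecK x) iter_rhoE ?hvec_neq0. Qed.

(** Since [sn q] = 0 and the recurrence gives [sn q.+1] = - [sn q.-1], the q-th power of the matrix
    is scalar. *)
Lemma iter_rho_q x : iter q rho x = x.
Proof.
have s1 : 0 < sn q.-1 by rewrite sn_gt0 //; case: q q3 => [//|[//|n]] _ /=.
have eq_q : q = q.-1.+1 by case: q q3.
transitivity (iter q.-1.+1 rho x); first by rewrite -eq_q.
rewrite iter_rho_xreal sn_rec -eq_q snq.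
transitivity (proj (- sn q.-1 * (hvec x).1, - sn q.-1 * (hvec x).2)).
  by congr (proj (_, _)); ring.
by rewrite (proj_scale (hvec x)) ?hvecK // oppr_eq0 gt_eqF.
Qed.

Lemma iter_rho_pred x : iter q.-1 rho (rho x) = x.
Proof. by rewrite -iterSr prednK ?iter_rho_q //; apply: leq_trans q3. Qed.

Lemma iter_rho_pred_oo : iter q.-1 rho oo = Some 0.
Proof. by rewrite -[RHS]iter_rho_pred /= eqxx. Qed.

(* Both predicates contain the endpoints 0 and infinity. *)
Definition nonpos (x : xreal R) : Prop := if x is Some r then r <= 0 else True.
Definition nonneg (x : xreal R) : Prop := if x is Some r then 0 <= r else True.

(** All reduces to the signs of [sn], nonnegative on [0, q] and zero only at its ends. The two
    closed half-lines share 0 and oo; the last two clauses restrict how a shared endpoint can be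
    reached. *)
Lemma rho_ping_pong i x : (0 < i < q)%N -> nonpos x ->
  [/\ nonneg (iter i rho x),
      iter i rho x = oo -> i = 1 /\ x = Some 0 &
      iter i rho x = Some 0 -> i = q.-1 /\ x = oo].
Proof.
case: i => [//|i] /andP[_ iq]; rewrite iter_rho_xreal.
have s1 : 0 < sn i.+1 by rewrite sn_gt0.
have s0 : 0 <= sn i by rewrite sn_ge0 // ltnW // ltnW.
have s2 : 0 <= sn i.+2 by rewrite sn_ge0.
case: x => [r|] /= r0; rewrite /proj /= ?mulr1 ?mulr0 ?subr0; last first.
  rewrite gt_eqF //; split=> //; first by rewrite /= divr_ge0 // ltW.
  case=> /eqP; rewrite mulf_eq0 invr_eq0 (gt_eqF s1) orbF => /eqP e; split=> //.
  (* Otherwise the vanishing numerator [sn i.+2] would be positive. *)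
  have : ~~ (i.+2 < q)%N.
    by apply/negP => lt_iq; move: (@sn_gt0 i.+2 lt_iq); rewrite e ltxx.
  by rewrite -leqNgt => qi; have /eqP <- : i.+2 == q by rewrite eqn_leq iq qi.
have num : sn i.+2 * r - sn i.+1 < 0 by nra.
have den : sn i.+1 * r - sn i <= 0 by nra.
case: eqP => [e|/eqP ne]; split=> //.
(* For i > 0 the denominator would be negative. *)
- move=> _; have i0 : i = 0%N.
    apply/eqP/negPn/negP; rewrite -lt0n => i0.
    have := @sn_gt0 i; rewrite i0 (ltnW iq) => /(_ isT); nra.
  split; first by rewrite i0.
  move/eqP: e; rewrite i0 sn0 subr0 mulf_eq0 -i0 (gt_eqF s1) /= => /eqP ->.
  by [].
- by rewrite /= mulr_le0 // ?invr_le0 // ltW.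
- case=> /eqP; rewrite mulf_eq0 invr_eq0 (negPf ne) orbF => /eqP e.
  by rewrite e ltxx in num.
Qed.

Lemma sigma_nonneg x : nonneg x -> nonpos (sigma x).
Proof.
case: x => [x|] //= x0; case: eqP => // _ /=.
by rewrite mulN1r oppr_le0 invr_ge0.
Qed.

Lemma sigma_eq_oo x : sigma x = oo -> x = Some 0.
Proof. by move=> e; rewrite -(sigmaK x) e. Qed.

Lemma sigma_eq_0 x : sigma x = Some 0 -> x = oo.
Proof. by move=> e; rewrite -(sigmaK x) e /= eqxx. Qed.

End HeckeAction.

(** * Edges and paths of the Farey graph *)

Section PathHomotopy.
Variables (R : realType) (q : nat).
Hypothesis q3 : (3 <= q)%N.

Local Notation rho := (@rho R q).
Local Notation tau := (@tau R q).
Local Notation sigma := (@sigma R).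
Local Notation oo := (infty R).
Local Notation G := (hecke_group (R:=R) q).
Local Notation V := (farey_vertex (R:=R) q).
Local Notation adj := (fun u v : xreal R => `[< farey_adj q u v >]).

Lemma sigma_hecke : G sigma. Proof. by apply: gen_base; left. Qed.

Lemma rho_hecke : G rho.
Proof.
have -> : rho = tau \o sigma.
  by rewrite -rho_sigma; apply/funext => x /=; rewrite sigmaK.
by apply: gen_comp sigma_hecke; apply: gen_base; right.
Qed.

Lemma adj_sigma g : G g -> adj (g oo) (g (sigma oo)).
Proof. by move=> Gg; apply/asboolP; exists g => //; rewrite setUC. Qed.

Lemma adj_rho g : G g -> adj (g oo) (g (rho oo)).
Proof.
move=> Gg; apply/asboolP; exists (g \o rho); first exact: gen_comp rho_hecke.
by rewrite /= eqxx.
Qed.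

(** Edges are unordered pairs; precomposing with [sigma], which swaps 0 and oo, orients them at
    will. *)
Lemma adjP u v : farey_adj q u v ->
  exists2 h, G h & h oo = u /\ h (sigma oo) = v.
Proof.
case=> g Gg e.
have [g0 goo] : [set u; v] (g (Some 0)) /\ [set u; v] (g oo).
  by rewrite e; split; [left | right].
have [eu ev] : [set g (Some 0); g oo] u /\ [set g (Some 0); g oo] v.
  by rewrite -e; split; [left | right].
have [[uE vE]|[uE vE]] : u = g oo /\ v = g (Some 0) \/ u = g (Some 0) /\ v = g oo.
  case: g0; case: goo; case: eu; case: ev => /= *;
    by [left; split; congruence | right; split; congruence].
  by exists g.
exists (g \o sigma); first exact: gen_comp sigma_hecke.
by rewrite /= eqxx.
Qed.

Lemma adj_vertex u v : farey_adj q u v -> V u /\ V v.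
Proof.
case/adjP=> h Gh [<- <-]; split; first by exists h.
by exists (h \o sigma) => //; exact: gen_comp sigma_hecke.
Qed.

Lemma farey_pathE x s : farey_path q (x :: s) <-> V x /\ path adj x s.
Proof.
split=> [[_ vx ax]|[vx /(pathP oo) ax]].
  split; first exact: (vx 0%N).
  by apply/(pathP oo) => i ilt; apply/asboolP/ax.
split=> // [[//|i]|i] ilt; last exact/asboolP/ax.
by have /asboolP/adj_vertex[] := ax i ilt.
Qed.

(** * Homotopy of subpaths *)

Lemma homotopic_sym (p p' : seq (xreal R)) : homotopic q p p' -> homotopic q p' p.
Proof.
elim=> [s t [ps pt i]|s|s t r _ IH1 _ IH2]; last exact: rt_trans IH2 IH1.
  by apply: rt_step; split=> //; case: i; [right|left].
exact: rt_refl.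
Qed.

(* The walks [u :: s] and [u :: t] have the same end and may replace one another
   inside any longer path, up to homotopy. *)
Definition seg_homotopic (u : xreal R) (s t : seq (xreal R)) : Prop :=
  last u s = last u t /\
  forall x r z, V x -> path adj x r -> last x r = u -> path adj (last u s) z ->
    homotopic q (x :: r ++ s ++ z) (x :: r ++ t ++ z).

Lemma seg_refl u s : seg_homotopic u s s.
Proof. by split=> // *; exact: rt_refl. Qed.

Lemma seg_sym u s t : seg_homotopic u s t -> seg_homotopic u t s.
Proof.
case=> e H; split=> // x r z Vx xr ru uz.
by apply/homotopic_sym/H => //; rewrite e.
Qed.

Lemma seg_trans u s t r :
  seg_homotopic u s t -> seg_homotopic u t r -> seg_homotopic u s r.
Proof.
case=> e H [e' H']; split=> [|x y z Vx xr ru uz]; first by rewrite e.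
by apply: (rt_trans _ _ _ _ _ (H _ _ _ _ _ _ _)) (H' _ _ _ _ _ _ _); rewrite -?e.
Qed.

Lemma seg_cat2r u s t z : path adj (last u s) z ->
  seg_homotopic u s t -> seg_homotopic u (s ++ z) (t ++ z).
Proof.
move=> uz [e H]; split=> [|x r z' Vx xr ru]; first by rewrite !last_cat e.
by rewrite last_cat => z'P; rewrite -!catA; apply: H; rewrite // cat_path uz.
Qed.

Lemma seg_cat2l u r s t : path adj u r ->
  seg_homotopic (last u r) s t -> seg_homotopic u (r ++ s) (r ++ t).
Proof.
move=> ur [e H]; split=> [|x r' z Vx xr r'u]; first by rewrite !last_cat e.
rewrite last_cat => zP; rewrite -!catA !(catA r').
by apply: H; rewrite // ?cat_path ?last_cat r'u // xr.
Qed.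

Lemma seg_insertion u s : path adj u s -> last u s = u ->
  (forall p1 p2, insertion q (p1 ++ u :: p2) (p1 ++ (u :: s) ++ p2)) ->
  seg_homotopic u s [::].
Proof.
move=> us su ins; split=> // x r z Vx xr ru; rewrite su => uz.
apply: rt_step; split; rewrite ?farey_pathE ?cat_path ?ru ?us ?su ?xr //.
by right; rewrite -!cat_cons (lastI x r) ru !cat_rcons; exact: ins.
Qed.

Lemma seg_backtrack u w : adj u w -> adj w u -> seg_homotopic u [:: w; u] [::].
Proof.
move=> uw wu; apply: seg_insertion => [|//|p1 p2]; first by rewrite /= uw wu.
by apply: insert_backtrack; apply/asboolP.
Qed.

(** * Words in [sigma] and [rho], and their walks *)

Definition letter (b : bool) : xreal R -> xreal R := if b then sigma else rho.

Definition ev (w : seq bool) : xreal R -> xreal R :=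
  foldr (fun b f => letter b \o f) id w.

(* The walk from [g oo] visiting the points [g (ev w1 oo)], [w1] a nonempty
   prefix of [w]. *)
Fixpoint walk (g : xreal R -> xreal R) (w : seq bool) : seq (xreal R) :=
  if w is b :: w' then g (letter b oo) :: walk (g \o letter b) w' else [::].

Lemma ev_cat w1 w2 : ev (w1 ++ w2) = ev w1 \o ev w2.
Proof. by elim: w1 => //= b w1 ->. Qed.

Lemma ev_nseq i : ev (nseq i false) = iter i rho.
Proof. by elim: i => //= i ->. Qed.

Lemma letter_hecke b : G (letter b).
Proof. by case: b; [exact: sigma_hecke | exact: rho_hecke]. Qed.

Lemma ev_hecke w : G (ev w).
Proof.
elim: w => [|b w IH]; first exact: gen_id.
exact: gen_comp (letter_hecke b) IH.
Qed.

Lemma walk_cat g w1 w2 : walk g (w1 ++ w2) = walk g w1 ++ walk (g \o ev w1) w2.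
Proof. by elim: w1 g => //= b w1 IH g; rewrite IH. Qed.

Lemma last_walk g w : last (g oo) (walk g w) = g (ev w oo).
Proof. by elim: w g => //= b w IH g; exact: (IH (g \o letter b)). Qed.

Lemma path_walk g w : G g -> path adj (g oo) (walk g w).
Proof.
elim: w g => //= b w IH g Gg; apply/andP; split; last first.
  by apply: (IH (g \o letter b)); apply: gen_comp => //; exact: letter_hecke.
by case: b; [exact: adj_sigma | exact: adj_rho].
Qed.

Lemma walk_nseq g i :
  walk g (nseq i false) = [seq g (iter j rho oo) | j <- iota 1 i].
Proof.
elim: i => // i IH.
rewrite -addn1 nseqD walk_cat IH iotaD map_cat ev_nseq.
by rewrite -[walk (g \o iter i rho) _]/[:: g (iter i rho (rho oo))] -iterSr.
Qed.

Lemma walk_face g : G g -> boundary_circuit q (g oo :: walk g (nseq q false)).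
Proof.
move=> Gg; exists g => //; exists 0%N, (g oo), (walk g (nseq q.-1 false)).
have eq_q : q = q.-1.+1 by case: q q3.
rewrite rot0 /face !walk_nseq; have -> : iota 0 q = 0%N :: iota 1 q.-1.
  by rewrite [in LHS]eq_q.
(* The closing vertex has index q, and [rho]^q = id brings it back to [g oo]. *)
split=> //; left; have -> : iota 1 q = rcons (iota 1 q.-1) q.
  by rewrite [in LHS]eq_q -(addn1 q.-1) iotaD cats1 add1n -eq_q.
by rewrite map_rcons iter_rho_q.
Qed.

Lemma seg_circuit g : G g -> seg_homotopic (g oo) (walk g (nseq q false)) [::].
Proof.
move=> Gg; apply: seg_insertion => [||p1 p2]; first exact: path_walk.
  by rewrite last_walk ev_nseq iter_rho_q.
exact/insert_circuit/walk_face.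
Qed.

Lemma seg_walk_cat2l g w1 w2 w2' : G g ->
  seg_homotopic (g (ev w1 oo)) (walk (g \o ev w1) w2) (walk (g \o ev w1) w2') ->
  seg_homotopic (g oo) (walk g (w1 ++ w2)) (walk g (w1 ++ w2')).
Proof.
move=> Gg H; rewrite !walk_cat; apply: seg_cat2l; first exact: path_walk.
by rewrite last_walk.
Qed.

(* A loop prefix [w1] moves the base frame from [g] to [g \o ev w1]. *)
Lemma seg_walk_loop g w1 w2 : G g -> ev w1 oo = oo ->
  seg_homotopic (g oo) (walk g w1) [::] ->
  seg_homotopic (g oo) (walk g (w1 ++ w2)) (walk (g \o ev w1) w2).
Proof.
move=> Gg w1o H; rewrite walk_cat; apply: (@seg_cat2r _ _ [::]) => //.
rewrite last_walk; apply: (@path_walk (g \o ev w1)).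
exact: gen_comp (ev_hecke _).
Qed.

(* This is the circuit of the face [h E], [h = g sigma rho^(q-1)]. *)
Lemma seg_sigma_rho g : G g ->
  seg_homotopic (g oo) (walk g (true :: nseq q.-1 false)) [::].
Proof.
move=> Gg; set h := g \o (sigma \o iter q.-1 rho).
have eq_q : q = q.-1.+1 by case: q q3.
have ho : h oo = g oo.
  by rewrite /h /= iter_rho_pred_oo //= eqxx.
have hr : h \o rho = g \o sigma.
  by apply/funext => x; rewrite /h /= iter_rho_pred.
have Gh : G h.
  apply: gen_comp => //; apply: gen_comp; first exact: sigma_hecke.
  by rewrite -ev_nseq; exact: ev_hecke.
have := seg_circuit Gh; rewrite ho.
have -> : nseq q false = false :: nseq q.-1 false by rewrite {1}eq_q.
by rewrite /= -[h (Some _)]/((h \o rho) oo) hr.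
Qed.

(** * Reduced words and closed walks *)

(* Words without factors [sigma sigma] and [rho ^ q]; the flag tells that the
   word does not start with [rho], resp. does not start with [sigma]. *)
Inductive reduced : bool -> seq bool -> Prop :=
| red_nil b : reduced b [::]
| red_sigma w : reduced false w -> reduced true (true :: w)
| red_rho i w : (0 < i < q)%N -> reduced true w ->
    reduced false (nseq i false ++ w).

Lemma reducedN w : reduced true w ->
  w = [::] \/ exists2 w', w = true :: w' & reduced false w'.
Proof.
move=> H; inversion H; first by left.
by right; exists w0.
Qed.

Lemma reducedP w : reduced false w ->
  w = [::] \/ exists i w', [/\ (0 < i < q)%N, w = nseq i false ++ w' & reduced true w'].
Proof.
move=> H; inversion H; first by left.
by right; exists i, w0.
Qed.

(** Ping-pong starts at oo, a point of both half-lines, and each syllable maps one half-line into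
    the other. *)
Lemma ev_reduced b w : reduced b w ->
  if b then nonpos (ev w oo) else nonneg (ev w oo).
Proof.
elim=> [[]|{}w _ IH|i {}w iq _ IH] //; first exact: sigma_nonneg.
by rewrite ev_cat ev_nseq; have [] := rho_ping_pong q3 iq IH.
Qed.

Lemma reduce w : exists b w', [/\ reduced b w', ev w = ev w' &
  forall g, G g -> seg_homotopic (g oo) (walk g w) (walk g w')].
Proof.
elim: w => [|c w [b [w' [rw ew hw]]]].
  by exists true, [::]; split=> // [|g _]; [exact: red_nil | exact: seg_refl].
have step g : G g ->
    seg_homotopic (g oo) (walk g (c :: w)) (walk g (c :: w')).
  move=> Gg; apply: (@seg_walk_cat2l g [:: c]) => //; apply: hw.
  exact: gen_comp (letter_hecke c).
have eqc : ev (c :: w) = ev (c :: w') by rewrite /= ew.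
have stop b' : reduced b' (c :: w') -> exists b w', [/\ reduced b w',
    ev (c :: w) = ev w' &
    forall g, G g -> seg_homotopic (g oo) (walk g (c :: w)) (walk g w')].
  by move=> r'; exists b', (c :: w').
have cancel_ b' w1 w2 : c :: w' = w1 ++ w2 -> ev w1 = id -> reduced b' w2 ->
    (forall g, G g -> seg_homotopic (g oo) (walk g w1) [::]) ->
    exists b w', [/\ reduced b w', ev (c :: w) = ev w' &
      forall g, G g -> seg_homotopic (g oo) (walk g (c :: w)) (walk g w')].
  move=> e e1 r2 H; exists b', w2; split=> //; first by rewrite eqc e ev_cat e1.
  move=> g Gg; apply: seg_trans (step g Gg) _; rewrite e.
  by have := @seg_walk_loop g w1 w2 Gg; rewrite e1; apply=> //; exact: H.
case: c stop cancel_ {step eqc} => stop cancel_.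
  case: b rw => rw; last exact/stop/red_sigma.
  have [e|[w2 e r2]] := reducedN rw.
    by apply: stop; rewrite e; apply: red_sigma; exact: red_nil.
  apply: (cancel_ false [:: true; true] w2) => //; first by rewrite e.
    by apply/funext => x /=; rewrite sigmaK.
  move=> g Gg; rewrite /= eqxx; apply: seg_backtrack; first exact: (adj_sigma Gg).
  have := @adj_sigma (g \o sigma); rewrite /= eqxx; apply.
  exact: gen_comp sigma_hecke.
have lt1 : (0 < 1 < q)%N by apply: leq_trans q3.
case: b rw => rw; first exact/stop/(red_rho lt1).
have [e|[i [w2 [/andP[i0 iq] e r2]]]] := reducedP rw.
  by apply: stop; rewrite e; apply: (red_rho lt1); exact: red_nil.
(* The leading block of [rho] grows to length [i.+1], still below q or equal to q. *)
have [ltiq|] := ltnP i.+1 q.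
  by apply: stop; rewrite e; apply: (@red_rho i.+1).
move=> qi; have qE : i.+1 = q by apply/eqP; rewrite eqn_leq iq.
apply: (cancel_ true (nseq q false) w2) => //; first by rewrite e -qE.
  by rewrite ev_nseq; apply/funext => x; rewrite iter_rho_q.
exact: seg_circuit.
Qed.

(** The endpoint clauses of [rho_ping_pong] determine the leading block. The two prefixes act as
    [tau] and its inverse: they fix oo without being the identity. *)
Lemma reduced_closed b w : reduced b w -> ev w oo = oo ->
  w = [::] \/
  exists b' w1 w2, [/\ w = w1 ++ w2,
    w1 = [:: false; true] \/ w1 = true :: nseq q.-1 false,
    reduced b' w2 & ev w2 oo = oo].
Proof.
case: b => rw.
  have [->|[w' -> rw']] := reducedN rw; first by left.
  move=> we; have {we} : ev w' oo = Some 0 by exact: sigma_eq_oo we.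
  have [->//|[i [w2 [iq -> r2]]]] := reducedP rw'.
  rewrite ev_cat ev_nseq /=.
  have [_ _ H /H[e w2o]] := rho_ping_pong q3 iq (ev_reduced r2).
  right; exists true, (true :: nseq i false), w2; split=> //; right.
  by rewrite e.
have [->|[i [w2 [iq -> r2]]]] := reducedP rw; first by left.
rewrite ev_cat ev_nseq /=.
(* Reaching oo needs a block of length 1 and [w2] sending oo to 0; so [w2] is nonempty and starts
   with sigma. *)
have [_ H _ /H[-> w2o]] := rho_ping_pong q3 iq (ev_reduced r2).
move: w2o; have [->//|[w3 -> r3]] := reducedN r2.
move=> we; have {we} w3o : ev w3 oo = oo by exact: sigma_eq_0 we.
right.
by exists false, [:: false; true], w3; split=> //; left.
Qed.

(** Induction on length. Once the prefix is removed, the rest is walked in the frame [g \o ev w1],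
    so [g] must vary in the induction. *)
Lemma seg_reduced_closed b w g : reduced b w -> ev w oo = oo -> G g ->
  seg_homotopic (g oo) (walk g w) [::].
Proof.
elim: {w}_.+1 {-2}w (ltnSn (size w)) b g => // n IH w wn b g rw wo Gg.
have [->|[b' [w1 [w2 [e w1E r2 w2o]]]]] := reduced_closed rw wo.
  exact: seg_refl.
have [w1o H1] : ev w1 oo = oo /\ seg_homotopic (g oo) (walk g w1) [::].
  case: w1E => ->; last first.
    split; last exact: seg_sigma_rho.
    by rewrite /= ev_nseq iter_rho_pred_oo //= eqxx.
  split; first by rewrite /= eqxx.
  rewrite /= eqxx; apply: seg_backtrack; first exact: (adj_rho Gg).
  by have := adj_sigma (gen_comp Gg rho_hecke); rewrite /= eqxx.
have H := seg_walk_loop w2 Gg w1o H1.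
rewrite e; apply: seg_trans H _.
have lt_w2 : (size w2 < n)%N.
  rewrite ltnS in wn; apply: leq_trans wn; rewrite e size_cat.
  by case: w1E => -> /=; rewrite addSn ltnS leq_addl.
have := IH w2 lt_w2 b' (g \o ev w1) r2 w2o; rewrite /= w1o; apply.
exact: gen_comp (ev_hecke _).
Qed.

Lemma seg_closed w g : ev w oo = oo -> G g ->
  seg_homotopic (g oo) (walk g w) [::].
Proof.
move=> wo Gg; have [b [w' [rw ew H]]] := reduce w.
apply: seg_trans (H g Gg) _; apply: seg_reduced_closed rw _ Gg.
by rewrite -ew.
Qed.

(** * From words to arbitrary paths *)

(** As [rho]^-1 = [rho]^(q-1), words without inverse letters suffice. *)
Lemma ev_inv w : exists w', cancel (ev w) (ev w') /\ cancel (ev w') (ev w).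
Proof.
elim: w => [|b w [w' [K K']]]; first by exists [::].
have [v [L L']] : exists v, cancel (letter b) (ev v) /\ cancel (ev v) (letter b).
  case: b; first by exists [:: true]; split; exact: sigmaK.
  have eq_q : q = q.-1.+1 by case: q q3.
  exists (nseq q.-1 false); rewrite ev_nseq; split=> x /=.
    exact: iter_rho_pred.
  by rewrite -iterS -eq_q iter_rho_q.
exists (w' ++ v); rewrite ev_cat; split=> x /=; first by rewrite L K.
by rewrite K' L'.
Qed.

Lemma hecke_word g : G g -> exists w, g = ev w.
Proof.
elim=> [f [->|->]||f h _ [w ->] _ [w' ->]|f h _ [w ->] K K'].
- by exists [:: true].
- by exists [:: false; true]; rewrite -rho_sigma.
- by exists [::].
- by exists (w ++ w'); rewrite ev_cat.
have [w' [L _]] := ev_inv w; exists w'.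
by apply/funext => x; rewrite -{2}(K' x) L.
Qed.

Lemma path_word s g : G g -> path adj (g oo) s ->
  exists w, seg_homotopic (g oo) s (walk g w).
Proof.
elim: s g => [|v s IH] g Gg /=; first by exists [::]; exact: seg_refl.
case/andP=> /asboolP/adjP[h Gh [ho hv]] vs.
have [k ek] : exists k, h = g \o ev k.
  have [w1 e1] := hecke_word Gg; have [w2 e2] := hecke_word Gh.
  have [w1' [_ L]] := ev_inv w1; exists (w1' ++ w2).
  by apply/funext => x; rewrite e1 e2 ev_cat /= L.
have Ghs : G (h \o sigma) by exact: gen_comp sigma_hecke.
have ko : ev k oo = oo.
  have [w1 e1] := hecke_word Gg; have [w1' [L _]] := ev_inv w1.
  by apply: (can_inj L); rewrite -e1 -ho ek.
rewrite -hv in vs *; have [w' Hw] := IH (h \o sigma) Ghs vs.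
(* The closed walk of [k] changes the frame from [g] to [h], in which the first edge is the letter
   sigma. *)
exists (k ++ true :: w').
apply: (@seg_trans _ _ (walk h (true :: w'))).
  apply: (@seg_cat2l _ [:: h (sigma oo)]) => //=.
  by rewrite -ho (adj_sigma Gh).
by rewrite ek; apply: seg_sym; apply: seg_walk_loop => //; exact: seg_closed.
Qed.

End PathHomotopy.

Theorem theorem5 (R : realType) (q : nat) (p p' : seq (xreal R)) :
  (3 <= q)%N ->
  farey_path q p -> farey_path q p' ->
  head (infty R) p = head (infty R) p' ->
  last (infty R) p = last (infty R) p' ->
  homotopic q p p'.
Proof.
move=> q3; case: p => [[]//|x s]; case: p' => [_ []//|y t].
move=> /farey_pathE[Vx xs] /farey_pathE[_ yt] /= xy; rewrite -{y}xy in yt *.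
move=> st; case: (Vx) => g Gg gx; rewrite -{}gx in Vx xs yt st *.
have [w Hw] := path_word q3 Gg xs; have [w' Hw'] := path_word q3 Gg yt.
suff [_ /(_ (g (infty R)) [::] [::])] : seg_homotopic q (g (infty R)) s t.
  by rewrite !cats0; apply.
apply: (seg_trans Hw (seg_trans _ (seg_sym Hw'))).
(* The common endpoint is the image under [g] of both points, and [g] is injective. *)
have e : ev q w (infty R) = ev q w' (infty R).
  have [v ev_g] := hecke_word q3 Gg; have [v' [L _]] := ev_inv R q3 v.
  apply: (can_inj L); rewrite -ev_g -!last_walk.
  by rewrite -Hw.1 -Hw'.1.
(* Here [w1] acts as the inverse of [w]. In the walk of w w1 w', both the part w1 w', in the frame
   [g \o ev w], and the part w w1 are closed; deleting one or the other leaves the walk of [w] or of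
   [w']. *)
have [w1 [L L']] := ev_inv R q3 w.
apply: (@seg_trans _ _ _ _ (walk q g (w ++ w1 ++ w'))).
  rewrite -{1}(cats0 w); apply: seg_walk_cat2l => //; apply: seg_sym.
  apply: (@seg_closed R q q3 (w1 ++ w') (g \o ev q w)).
    by rewrite ev_cat /= -e L.
  exact: gen_comp (ev_hecke _ _ _).
have H : ev q (w ++ w1) = id :> (xreal R -> _).
  by apply/funext => x'; rewrite ev_cat /= L'.
have := @seg_walk_loop R q g (w ++ w1) w' Gg; rewrite H -catA; apply=> //.
by apply: seg_closed => //; rewrite H.
Qed.
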